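(* There exists a family $F\subseteq\mathbb{R}^\omega$ of cardinality $2^{\aleph_0}$ such that any two distinct elements of $F$ are orthogonal and $F\subseteq l_p$ for every real $p>2$.
   Context: $\omega=\{0,1,2,\dots\}$ and $\mathbb{R}^\omega$ is the set of all real sequences. For $x,y\in\mathbb{R}^\omega$ the inner product is $(x,y)=\sum_{n\in\omega}x(n)y(n)$, which need not be finite or exist; $x$ and $y$ are orthogonal if the series $(x,y)$ converges (as the limit of its partial sums) and equals $0$. $l_p$ is the set of all $x\in\mathbb{R}^\omega$ with $\sum_{n\in\omega}|x(n)|^p<\infty$. *)

(* Defs.v *)
From HB Require Import structures.
From mathcomp Require Import all_boot all_order all_algebra.
From mathcomp Require Import all_classical all_reals all_analysis.

Set Implicit Arguments.
Unset Strict Implicit.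
Unset Printing Implicit Defensive.

Import Order.TTheory GRing.Theory Num.Theory.
Import numFieldNormedType.Exports.

Local Open Scope classical_set_scope.
Local Open Scope ring_scope.

(* Convergence is that of the partial sums, possibly only conditional; the
   claim that the limit exists is part of the definition. *)
Definition orthogonal_seq (R : realType) (x y : R^nat) : Prop :=
  series (fun n => x n * y n) @ \oo --> (0 : R).

(* powR satisfies 0 `^ p = 0 for p != 0, but 0 `^ 0 = 1; only p > 0 is meant. *)
Definition l_space (R : realType) (p : R) : set (R^nat) :=
  [set x | (\sum_(0 <= n <oo) (`|x n| `^ p)%:E < +oo)%E].

(* Main.v *)
Require Import Defs.
From HB Require Import structures.
From mathcomp Require Import all_boot all_order all_algebra.
From mathcomp Require Import all_classical all_reals all_analysis.
From mathcomp Require Import ring lra.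

Set Implicit Arguments.
Unset Strict Implicit.
Unset Printing Implicit Defensive.

Import Order.TTheory GRing.Theory Num.Theory.
Import numFieldNormedType.Exports.

Local Open Scope classical_set_scope.
Local Open Scope ring_scope.

(** The vectors are indexed by the branches [f : nat -> bool] of the binary tree
    and live on coordinates [(s, j)], where [s] is a node (a finite 0-1 word) and
    [j < width (size s)]; [pickle] turns such a pair into a natural number.
    The vector of [f] is supported on the nodes lying on the branch, and on the
    node of level [n] it is constant with value [+- height n], the sign being
    given by the next bit [f n].

    Orthogonality.  Let two branches share their nodes up to level [d] and part
    there.  They have no common node above level [d], so their product is
    finitely supported.  On the levels [m < d] the signs agree and the level
    contributes its full energy [width m * height m ^ 2]; on level [d] the signs
    differ and the level contributes minus its energy.  With energies
    1, 1, 2, 4, 8, ... every level from level 1 on has exactly the energy of all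
    lower levels together, so everything cancels ([branch_vec_orthogonal]).  This needs
    [d > 0], which holds as soon as the branches start with the same bit; hence
    only the branches starting with [false] are used ([rooted]).

    Summability.  The energies are fixed, and so the vectors are not in l_2, but
    the energy of a level may be spread over as many coordinates as desired.
    For [p = 2 + r] a level contributes [energy * height ^ r] to the sum of p-th
    powers; with [height n = 2 ^ - n ^ 2] this is at most [2 ^ (n - r n ^ 2)],
    which is summable for every [r > 0] ([branch_vec_l_space]). *)

(** * Sequences and prefixes *)

(** Finite support makes the order of the terms irrelevant, so that sums can be
    computed node by node whatever the enumeration [pickle] is. *)
Lemma series_finite_support (R : realType) (u : R^nat) (s : seq nat) :
  uniq s -> (forall k, k \notin s -> u k = 0) ->
  series u @ \oo --> (\sum_(k <- s) u k : R).
Proof.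
move=> us u0; apply: cvg_near_cst; exists (\max_(k <- s) k).+1 => // n /= hn.
rewrite /series /=.
rewrite (bigID (mem s)) /= [X in _ + X]big1 => [|k /u0//]; rewrite addr0.
rewrite -big_filter; apply: perm_big; apply: uniq_perm => //.
  by rewrite filter_uniq// iota_uniq.
move=> k; rewrite mem_filter mem_index_iota /=.
case: (boolP (k \in s)) => //= ks.
by apply: leq_trans hn; rewrite ltnS; apply: leq_bigmax_seq.
Qed.

Lemma eq_from_mkseq (T : eqType) (f g : nat -> T) :
  (forall n, mkseq f n = mkseq g n) -> f = g.
Proof.
move=> fg; apply/funext => n.
by have := congr1 (nth (f n) ^~ n) (fg n.+1); rewrite !nth_mkseq.
Qed.

Lemma mkseq_prefix (T : eqType) (f g : nat -> T) m n :
  (m <= n)%N -> mkseq f n = mkseq g n -> mkseq f m = mkseq g m.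
Proof.
move=> mn fg; rewrite /mkseq -(subnKC mn) !iotaD !map_cat in fg.
have := congr1 (take m) fg.
by rewrite !take_size_cat ?size_map ?size_iota.
Qed.

(** * The vector of a branch *)

(** Chosen so that [width n * height n ^ 2] is [2 ^ n.-1]: the truncated
    predecessor gives the two lowest levels the same energy 1. *)
Definition width (n : nat) : nat := (2 ^ n.-1 * 4 ^ (n ^ 2))%N.

Section Branch.
Variable R : realType.
Implicit Types (f g : nat -> bool) (n m j k : nat).

Definition height n : R := 2 ^- (n ^ 2)%N.

Definition branch_vec f k : R :=
  if pickle_inv k is Some (s, j) then
    if (s == mkseq f (size s)) && (j < width (size s))%N
    then (-1) ^+ f (size s) * height (size s) else 0
  else 0.

Lemma width_gt0 n : (0 < width n)%N.
Proof. by rewrite muln_gt0 !expn_gt0. Qed.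

Lemma height_gt0 n : 0 < height n.
Proof. by rewrite invr_gt0 exprn_gt0. Qed.

Lemma level_energy n : (width n)%:R * height n ^+ 2 = 2 ^+ n.-1.
Proof.
have h : 4 ^+ (n ^ 2)%N = (2 ^+ (n ^ 2)%N) ^+ 2 :> R.
  by rewrite -exprM mulnC exprM; congr (_ ^+ _); lra.
by rewrite /height natrM !natrX h exprVn -mulrA mulfV ?mulr1.
Qed.

Lemma branch_vec_node f n j : (j < width n)%N ->
  branch_vec f (pickle (mkseq f n, j)) = (-1) ^+ f n * height n.
Proof. by move=> jn; rewrite /branch_vec pickleK_inv size_mkseq eqxx jn. Qed.

Lemma branch_vec_support f k : branch_vec f k != 0 ->
  exists n j, (j < width n)%N /\ k = pickle (mkseq f n, j).
Proof.
rewrite /branch_vec; have := @pickle_invK (seq bool * nat)%type k.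
case: pickle_inv => [[s j]|] /=; last by rewrite eqxx.
move=> <-; case: ifP; last by rewrite eqxx.
by move=> /andP[/eqP es js] _; exists (size s), j; rewrite -es.
Qed.

Lemma branch_vec_meet f g k : branch_vec f k * branch_vec g k != 0 ->
  exists n j, [/\ (j < width n)%N, mkseq f n = mkseq g n
    & k = pickle (mkseq f n, j)].
Proof.
rewrite mulf_eq0 negb_or => /andP[/branch_vec_support[n [j [jn ->]]]].
move=> /branch_vec_support[m [i [im /(pcan_inj pickleK)[e _]]]].
exists n, j; split=> //; rewrite e.
by have := congr1 size e; rewrite !size_mkseq => ->.
Qed.

(** A branch is recovered from the nodes on which its vector does not vanish. *)
Lemma branch_vec_inj : injective branch_vec.
Proof.
move=> f g fg; apply: eq_from_mkseq => n.
have : branch_vec f (pickle (mkseq f n, 0%N))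
     * branch_vec g (pickle (mkseq f n, 0%N)) != 0.
  rewrite -fg -expr2 expf_neq0// branch_vec_node ?width_gt0//.
  by rewrite mulf_neq0 ?signr_eq0// gt_eqF// height_gt0.
case/branch_vec_meet => m [j [_ e /(pcan_inj pickleK)[e' _]]].
by have := congr1 size e'; rewrite !size_mkseq => ->.
Qed.

(** * Orthogonality *)

(** The terms are the energies of the levels [m]; their sum is the energy of the
    next level, which is what lets that level alone cancel the lower ones. *)
Lemma sum_pow_pred d : \sum_(0 <= m < d.+1) 2 ^+ m.-1 = 2 ^+ d :> R.
Proof.
elim: d => [|d IH]; first by rewrite big_nat1.
by rewrite big_nat_recr//= IH exprS; ring.
Qed.

Lemma first_difference f g : f <> g ->
  exists d, mkseq f d = mkseq g d /\ f d != g d.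
Proof.
move=> fg; have ex : exists n, f n != g n.
  apply: contrapT => h; apply: fg; apply/funext => n.
  by apply/eqP/negPn/negP => hn; apply: h; exists n.
exists (ex_minn ex); case: ex_minnP => d fd dmin; split => //.
apply/eq_in_map => i; rewrite mem_iota /= => id.
by apply/eqP/negPn/negP => /dmin; rewrite leqNgt id.
Qed.

(** The level at which the branches part has opposite signs, and cancels the
    energy of all lower levels. *)
Lemma branch_vec_orthogonal f g :
  f 0%N = g 0%N -> f <> g -> orthogonal_seq (branch_vec f) (branch_vec g).
Proof.
move=> fg0 /first_difference[d [fgd fd]].
(* Without a common lower level nothing could cancel the level [d]. *)
have d0 : (0 < d)%N.
  by rewrite lt0n; apply: contraNneq fd => ->; apply/eqP.
pose L := [seq (mkseq f m, j) | m <- iota 0 d.+1, j <- iota 0 (width m)].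
have Luniq : uniq (map pickle L).
  rewrite (map_inj_uniq (pcan_inj pickleK)).
  apply: allpairs_uniq_dep => [||]; [exact: iota_uniq| |].
    by move=> *; exact: iota_uniq.
  move=> [m i] [m' i'] _ _ /= [e ->].
  by have := congr1 size e; rewrite !size_mkseq => ->.
have agree m : (m < d)%N -> f m = g m.
  move=> md; have := congr1 (nth (f m) ^~ m) fgd.
  by rewrite !nth_mkseq.
suff sum0 : \sum_(k <- map pickle L) branch_vec f k * branch_vec g k = 0.
  rewrite /orthogonal_seq -sum0; apply: series_finite_support => // k.
  apply: contraNeq.
  case/branch_vec_meet => n [j [jn fgn ->]].
  apply: map_f; apply/allpairsPdep; exists n, j; split=> //.
    rewrite mem_iota /= add0n ltnS leqNgt; apply/negP => dn.
    have := congr1 (nth (f d) ^~ d) fgn; rewrite !nth_mkseq// => e.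
    by rewrite e eqxx in fd.
  by rewrite mem_iota.
rewrite big_map big_allpairs_dep.
transitivity (\sum_(0 <= m < d.+1)
  (-1) ^+ f m * (-1) ^+ g m * ((width m)%:R * height m ^+ 2)).
  rewrite /index_iota subn0.
  apply: eq_big_seq => m; rewrite mem_iota add0n ltnS => /andP[_ md].
  rewrite (eq_big_seq (fun=> (-1) ^+ f m * (-1) ^+ g m * height m ^+ 2)).
    rewrite big_const_seq count_predT size_iota iter_addr_0.
    by rewrite -mulr_natl; ring.
  move=> j; rewrite mem_iota add0n => /andP[_ jm].
  rewrite [in X in _ * X](mkseq_prefix md fgd) !branch_vec_node//; ring.
rewrite big_nat_recr//= level_energy.
have -> : (-1) ^+ f d * (-1) ^+ g d = -1 :> R.
  by move: fd; case: (f d); case: (g d) => //= _; ring.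
rewrite (eq_big_nat _ _ (F2 := fun m => 2 ^+ m.-1)) => [|m /andP[_ /agree ->]].
  by rewrite -{1}(prednK d0) sum_pow_pred; ring.
by rewrite level_energy -expr2 sqrr_sign mul1r.
Qed.

(** * Summability of p-th powers *)

(** With [r = p - 2] the exponent [n - r n ^ 2] is at most [1 / r - n], because
    [r n ^ 2 - 2 n + 1 / r] is the square [(r n - 1) ^ 2 / r].  This bounds the
    levels by a geometric sequence uniformly in [n].  The right-hand side is
    written in the shape of [epsilon_trick0]. *)
Lemma level_lp_mass_le (p : R) n : 2 < p ->
  (width n)%:R * height n `^ p <= 2 `^ (p - 2)^-1 * 2 / (2 ^ n.+1)%:R.
Proof.
move=> p2; have r0 : 0 < p - 2 by lra.
set r := p - 2 in r0 *.
have two0 : (2 : R) != 0 by [].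
have h0 : 0 <= height n by apply/ltW/height_gt0.
have -> : p = r + 2%:R by rewrite /r; ring.
rewrite powRD; last by rewrite (gt_eqF (height_gt0 n)) implybT.
rewrite powR_mulrn// mulrCA level_energy.
rewrite natrX exprS invfM -mulrA (mulrA 2) mulfV// mul1r.
rewrite ler_pdivlMr ?exprn_gt0//.
apply: (@le_trans _ _ (height n `^ r * 2 ^+ (n * 2)%N)).
  rewrite -mulrA ler_wpM2l ?powR_ge0// muln2 -addnn exprD ler_wpM2r ?exprn_ge0//.
  by rewrite ler_eXn2l ?leq_pred// ltr1n.
have -> : height n = 2 `^ (- (n ^ 2)%N%:R).
  by rewrite powRN powR_mulrn.
rewrite -powRrM -powR_mulrn// -powRD; last by rewrite two0 implybT.
rewrite ler_powR ?ler1n// natrX natrM.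
have : 0 <= (n%:R * r - 1) ^+ 2 / r by rewrite divr_ge0 ?sqr_ge0 ?ltW.
suff -> : (n%:R * r - 1) ^+ 2 / r = n%:R ^+ 2 * r - n%:R * 2 + r^-1 by lra.
by field; rewrite gt_eqF.
Qed.

(** Only the nodes of the branch contribute, so the sum over all coordinates
    is a sum over levels. *)
Lemma branch_vec_l_space f (p : R) : 2 < p -> l_space p (branch_vec f).
Proof.
move=> p2; rewrite /l_space /=.
have p0 : p != 0 by rewrite gt_eqF//; lra.
pose I := [set: nat] `*`` (fun n => `I_(width n)).
pose e (t : nat * nat) := pickle (mkseq f t.1, t.2).
rewrite nneseries_esumT; last by move=> k; rewrite lee_fin powR_ge0.
have -> : (\esum_(k in [set: nat]) (`|branch_vec f k| `^ p)%:E =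
           \esum_(k in e @` I) (`|branch_vec f k| `^ p)%:E)%E.
  rewrite [RHS]esum_mkcond; apply: eq_esum => k _.
  case: ifPn => // /negP kI; congr EFin.
  have [->|/branch_vec_support[n [j [jn ke]]]] := eqVneq (branch_vec f k) 0.
    by rewrite normr0 powR0.
  by case: kI; rewrite inE ke; exists (n, j).
rewrite esum_image; last first.
  move=> [m i] [n j] _ _ /(pcan_inj pickleK)[e' ->].
  by have := congr1 size e'; rewrite !size_mkseq => ->.
rewrite -(@esum_esum _ _ _ _ _
  (fun n j => (`|branch_vec f (e (n, j))| `^ p)%:E)); last first.
  by move=> *; rewrite lee_fin powR_ge0.
rewrite (eq_esum (b := fun n => ((width n)%:R * height n `^ p)%:E)); last first.
  move=> n _; rewrite esum_fset; last 2 first.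
  - exact: finite_II.
  - by move=> *; rewrite lee_fin powR_ge0.
  rewrite -fsbig_ord /= sumEFin; congr EFin.
  rewrite (eq_bigr (fun=> height n `^ p)); last first.
    move=> j _; rewrite /e /= branch_vec_node// normrM normr_sign mul1r.
    by rewrite gtr0_norm// height_gt0.
  by rewrite sumr_const card_ord mulr_natl.
rewrite -nneseries_esumT; last first.
  by move=> n; rewrite lee_fin mulr_ge0 ?ler0n ?powR_ge0.
apply: (@le_lt_trans _ _ (2 `^ (p - 2)^-1 * 2)%:E); last exact: ltry.
apply: le_trans (epsilon_trick0 xpredT _); last by rewrite mulr_ge0 ?powR_ge0.
apply: lee_nneseries => [n _ _|n _].
  by rewrite lee_fin mulr_ge0 ?ler0n ?powR_ge0.
by rewrite lee_fin level_lp_mass_le.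
Qed.

End Branch.

(** * The family *)

Definition rooted (f : nat -> bool) (n : nat) : bool :=
  if n is m.+1 then f m else false.

Lemma rooted_inj : injective rooted.
Proof.
by move=> f g fg; apply/funext => n; have := congr1 (fun h => h n.+1) fg.
Qed.

Theorem theorem1 (R : realType) :
  exists F : set (R^nat),
    [/\ (F #= [set: nat -> bool])%card,
        (forall x y : R^nat, F x -> F y -> x <> y -> orthogonal_seq x y)
      & (forall p : R, 2 < p -> F `<=` l_space p)].
Proof.
exists ((fun f => branch_vec R (rooted f)) @` setT); split.
- apply: inj_card_eq => f g _ _ /branch_vec_inj; exact: rooted_inj.
- move=> _ _ [f _ <-] [g _ <-] fg; apply: branch_vec_orthogonal => // e.
  by apply: fg; rewrite e.
- by move=> p p2 _ [f _ <-]; apply: branch_vec_l_space.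
Qed.
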